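(* Let $A$ be a finite alphabet, let $F\colon A^{\mathbb{Z}}\to A^{\mathbb{Z}}$ be a cellular automaton and let $\mu$ be an $F$-invariant Borel probability measure on $A^{\mathbb{Z}}$ (not assumed to be shift-invariant) such that $F$ is $\mu$-equicontinuous. Then the measure-theoretic (Kolmogorov–Sinai) entropy $h_\mu(F)$ is equal to $0$.
   Context: $A^{\mathbb{Z}}$ carries the product topology of the discrete topology on the finite set $A$. A cellular automaton is a continuous map $F\colon A^{\mathbb{Z}}\to A^{\mathbb{Z}}$ commuting with the shift $\sigma(x)=(x_{i+1})_{i\in\mathbb{Z}}$. A measure $\mu$ is $F$-invariant if $\mu\circ F^{-1}=\mu$. For $n\in\mathbb{N}$ ($\mathbb{N}$ contains $0$) and $x\in A^{\mathbb{Z}}$ put $C_n(x)=\{y: y_j=x_j \text{ for } -n\le j\le n\}$ and $B_n(x)=\{y: F^i(y)_j=F^i(x)_j \text{ for all } i\in\mathbb{N} \text{ and } -n\le j\le n\}$. A point $x$ is $\mu$-equicontinuous (also called $\mu$-almost equicontinuous) for $F$ if for all $m\in\mathbb{N}$, $\lim_{n\to\infty}\mu(C_n(x)\cap B_m(x))/\mu(C_n(x))=1$ (in particular $\mu(C_n(x))>0$ for all $n$). $F$ is $\mu$-equicontinuous if the set of $\mu$-equicontinuous points has $\mu$-measure $1$. *)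

(* Defs.v *)
From HB Require Import structures.
From mathcomp Require Import all_boot all_order all_algebra.
From mathcomp Require Import all_classical all_reals all_analysis.

Set Implicit Arguments.
Unset Strict Implicit.
Unset Printing Implicit Defensive.

Import Order.TTheory GRing.Theory Num.Theory.
Import numFieldNormedType.Exports.

Local Open Scope classical_set_scope.
Local Open Scope ring_scope.

(* Finite alphabets. Measurable types are pointed in the library, so the
   alphabet comes with a distinguished letter; it plays no other role. An empty
   alphabet would carry no probability measure on its configurations. *)
#[short(type="alphabetType")]
HB.structure Definition Alphabet := {A of Finite A & Pointed A}.

Definition config (A : alphabetType) : Type :=
  {ptws int -> discrete_topology A}.

HB.instance Definition _ (A : alphabetType) := Topological.on (config A).
HB.instance Definition _ (A : alphabetType) := Pointed.on (config A).

Notation borel_config A := (g_sigma_algebraType (@open (config A))).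

Section entropy.
Context {d : measure_display} {T : measurableType d} {R : realType}.
Variables (mu : probability T R) (f : T -> T).

(* Cells are allowed to be empty; these do not affect the entropy. *)
Definition measurable_partition (k : nat) (P : 'I_k -> set T) : Prop :=
  [/\ forall i, measurable (P i),
      trivIset [set: 'I_k] P &
      \bigcup_i P i = [set: T] ].

(* The library has [ln 0 = 0], which gives the convention 0 ln 0 = 0. *)
Definition partition_entropy (I : finType) (P : I -> set T) : R :=
  - \sum_(i : I) fine (mu (P i)) * ln (fine (mu (P i))).

(* The join of P, f^-1 P, ..., f^-(n-1) P, its cells being indexed by the
   itineraries of length n. *)
Definition iterated_join (k : nat) (P : 'I_k -> set T) (n : nat)
    (w : {ffun 'I_n -> 'I_k}) : set T :=
  \bigcap_(i in [set: 'I_n]) (iter i f @^-1` P (w i)).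

(* When [mu] is f-invariant and [P] is a measurable partition, the sequence
   below converges, by subadditivity of the entropy of the joins; so [limn] is
   then a genuine limit. *)
Definition entropy_wrt (k : nat) (P : 'I_k -> set T) : R :=
  limn (fun n : nat => partition_entropy (@iterated_join k P n) / n%:R).

Definition ks_entropy : \bar R :=
  ereal_sup [set h : \bar R | exists (k : nat) (P : 'I_k -> set T),
    measurable_partition P /\ h = (entropy_wrt P)%:E].

End entropy.

Section cellular_automata.
Context {A : alphabetType}.

Definition shift (x : config A) : config A := fun i : int => x (i + 1).

Definition cellular_automaton (F : config A -> config A) : Prop :=
  continuous F /\ forall x : config A, F (shift x) = shift (F x).

Definition cylinder (n : nat) (x : config A) : set (config A) :=
  [set y | forall j : int, - n%:Z <= j <= n%:Z -> y j = x j].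

Definition orbit_cylinder (F : config A -> config A) (n : nat) (x : config A) :
    set (config A) :=
  [set y | forall (i : nat) (j : int), - n%:Z <= j <= n%:Z ->
    iter i F y j = iter i F x j].

Context {R : realType}.
Variables (mu : probability (borel_config A) R) (F : config A -> config A).

Definition invariant_measure : Prop :=
  forall B : set (borel_config A), measurable B -> mu (F @^-1` B) = mu B.

Definition mu_equicontinuous_point (x : config A) : Prop :=
  (forall n : nat, (0 < mu (cylinder n x))%E) /\
  forall m : nat,
    (fun n : nat => fine (mu (cylinder n x `&` orbit_cylinder F m x)) /
                    fine (mu (cylinder n x))) @ \oo --> (1 : R).

Definition mu_equicontinuous : Prop :=
  mu [set x | mu_equicontinuous_point x] = 1%E.

End cellular_automata.

(* Main.v *)
Require Import Defs.
From mathcomp Require Import all_boot all_order all_algebra.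
From mathcomp Require Import all_classical all_reals all_analysis.
From mathcomp Require Import measurable_realfun ring lra zify.

(* Let B_m(x) be the set of points whose orbit has the same window [-m, m] as
   that of x at all times. If x is equicontinuous, then B_m(x) fills more than
   half of some cylinder around x; disjoint classes cannot fill more than half
   of the same cylinder, and there are countably many cylinders, so countably
   many classes B_m(r_i) carry all the mass, and finitely many of them carry it
   up to e. Approximate a partition P by one that only reads the window
   [-m, m]. The approximate P-itinerary is then constant on each B_m(r_i), so
   that up to a frequency of errors e the P-itineraries of length n are among N
   words, where N does not depend on n. Gibbs' inequality against the weights
   exp(-t D(w)), with D(w) the Hamming distance from w to these words, bounds
   the entropy of the n-th join by ln N + n (k exp(-t) + t e). *)

Set Implicit Arguments.
Unset Strict Implicit.
Unset Printing Implicit Defensive.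

Import Order.TTheory GRing.Theory Num.Theory.
Import numFieldNormedType.Exports.

Local Open Scope classical_set_scope.
Local Open Scope ring_scope.

(** * Entropy bounds for finite distributions *)

(** Sum of [ln y <= y - 1] at [y = expR (- D i) / z / p i], weighted by [p i]: the right-hand sides
    add up to at most [0] because the [expR (- D i)] add up to at most [z]. *)
Lemma gibbs (R : realType) (I : finType) (p D : I -> R) (z : R) :
  (forall i, 0 <= p i) -> \sum_i p i = 1 -> \sum_i expR (- D i) <= z ->
  - (\sum_i p i * ln (p i)) <= \sum_i p i * D i + ln z.
Proof.
move=> p0 p1 rz.
have z0 : 0 < z.
  apply: lt_le_trans rz; rewrite lt_neqAle sumr_ge0 ?andbT; last first.
    by move=> i _; exact: expR_ge0.
  apply/eqP => /esym s0; move: p1; rewrite big1 => [/eqP|i _].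
    by rewrite eq_sym oner_eq0.
  move: s0 => /eqP; rewrite psumr_eq0 => [/allP /(_ i)|j _]; last exact: expR_ge0.
  by rewrite mem_index_enum => /(_ isT); rewrite gt_eqF // expR_gt0.
have key i : - (p i * ln (p i)) - p i * D i - p i * ln z <=
    expR (- D i) / z - p i.
  have [->|pi0] := eqVneq (p i) 0.
    by rewrite !mul0r !subr0 oppr0; rewrite divr_ge0 ?expR_ge0 // ltW.
  have pi_gt0 : 0 < p i by rewrite lt_neqAle eq_sym pi0 p0.
  have -> : - (p i * ln (p i)) - p i * D i - p i * ln z =
      p i * ln (expR (- D i) / z / p i).
    rewrite !ln_div ?posrE ?divr_gt0 ?expR_gt0 // expRK; ring.
  have -> : expR (- D i) / z - p i = p i * (expR (- D i) / z / p i - 1).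
    by field; rewrite pi0 gt_eqF.
  rewrite ler_pM2l //; set y := _ / p i.
  have y0 : 0 < y by rewrite !divr_gt0 ?expR_gt0.
  by rewrite -[in ln y](subrKC 1 y) le_ln1Dx// ltrBrDl subrr.
rewrite -subr_ge0 opprK -[ln z]mul1r -p1 mulr_suml -!big_split/=.
rewrite -oppr_le0 -sumrN; apply: (@le_trans _ _ (\sum_i (expR (- D i) / z - p i))).
  by apply: ler_sum => i _; apply: le_trans (key i); rewrite !opprD; lra.
by rewrite sumrB p1 -mulr_suml subr_le0 ler_pdivrMr // mul1r.
Qed.

(** The Hamming distance adds up over positions, so the sum over words factors into sums over
    letters; in each, the letter [c i] contributes [1] and the others at most
    [k%:R * expR (- t)]. *)
Lemma sum_expR_hamming (R : realType) (n k : nat) (t : R) (c : 'I_n -> 'I_k) :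
  \sum_(w : {ffun 'I_n -> 'I_k})
    expR (- (t * (\sum_(i < n) (w i != c i))%:R)) <=
  (1 + k%:R * expR (- t)) ^+ n.
Proof.
have -> : \sum_(w : {ffun 'I_n -> 'I_k})
    expR (- (t * (\sum_(i < n) (w i != c i))%:R)) =
    \prod_(i < n) \sum_(a < k) expR (- (t * (a != c i)%:R)).
  rewrite bigA_distr_bigA/=; apply: eq_bigr => w _.
  by rewrite natr_sum mulr_sumr -sumrN expR_sum.
rewrite -[X in _ ^+ X](card_ord n) -prodr_const; apply: ler_prod => i _.
rewrite sumr_ge0 => [/=|a _]; last exact: expR_ge0.
rewrite (bigD1 (c i))//= eqxx mulr0 oppr0 expR0 lerD2l.
rewrite (eq_bigr (fun=> expR (- t))) => [|a ->]; last by rewrite mulr1.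
rewrite sumr_const -[leLHS]mulr_natl ler_wpM2r ?expR_ge0// ler_nat.
by rewrite -[leqRHS](card_ord k) max_card.
Qed.

(** * Cylinders as neighbourhood bases of configurations *)

Section cylinders.
Context {A : alphabetType}.
Implicit Types x y : config A.

Lemma cylinder_refl n x : cylinder n x x. Proof. by []. Qed.

Lemma cylinder_eq n x y : cylinder n x y -> cylinder n x = cylinder n y.
Proof.
by move=> xy; apply/seteqP; split => z h j hj; rewrite h// xy.
Qed.

Lemma cylinder_le m n x : (m <= n)%N -> cylinder n x `<=` cylinder m x.
Proof. by move=> mn y h j hj; apply: h; lia. Qed.

Lemma nbhs_coord x (j : int) : nbhs x [set y : config A | y j = x j].
Proof.
exact: (@proj_continuous int (fun=> discrete_topology A) j x [set x j]
  (discrete_set1 _)).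
Qed.

Lemma nbhs_cylinder n x : nbhs x (cylinder n x).
Proof.
have h (k : nat) : nbhs x [set y : config A | forall i : nat, (i < k)%N ->
    y (i%:Z - n%:Z) = x (i%:Z - n%:Z)].
  elim: k => [|k ih]; first exact: filterS filterT.
  apply: filterS (filterI ih (nbhs_coord x (k%:Z - n%:Z))) => y [h1 h2] i.
  by rewrite ltnS leq_eqVlt => /predU1P[->//|/h1].
apply: filterS (h (n.*2.+1)) => y hy j hj.
have -> : j = (absz (j + n%:Z)%R)%:Z - n%:Z by lia.
by apply: hy; lia.
Qed.

Lemma open_locally_cylinder n (P : set (config A)) :
  (forall x y, cylinder n x y -> P x -> P y) -> open P.
Proof.
move=> h; rewrite openE => x Px.
by apply: filterS (nbhs_cylinder n x) => y /h; exact.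
Qed.

Lemma open_cylinder n x : open (cylinder n x).
Proof.
apply: (@open_locally_cylinder n) => y z.
by move=> /cylinder_eq yz /cylinder_eq ->; rewrite yz.
Qed.

(** Otherwise points taken from the cylinders outside [U] would converge to [x] coordinatewise,
    hence in the product topology. *)
Lemma nbhs_cylinder_sub x (U : set (config A)) : nbhs x U ->
  exists n, cylinder n x `<=` U.
Proof.
move=> xU; apply: contrapT => /forallNP h.
have {h} /choice[y hy] n : exists y, cylinder n x y /\ ~ U y.
  by have /existsNP[y /not_implyP] := h n; exists y.
have cy : (y @ \oo) --> x.
  apply/cvg_sup => j V [/= _ [[W /= _ <-] /= Wx]] /filterS; apply.
  exists (absz j) => // n /= jn; rewrite /proj (_ : y n j = x j)//.
  by apply: (hy n).1; lia.
by have [n _ /(_ n (leqnn n))] := cy _ xU; have [] := hy n.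
Qed.

End cylinders.

(** * Entropy of joins whose itineraries are predicted by finitely many words *)

Section predictors.
Context {d : measure_display} {T : measurableType d} {R : realType}.
Variable mu : probability T R.

Lemma measurable_sum_indic (I : finType) (C : I -> set T) (g : I -> R) :
  (forall i, measurable (C i)) ->
  measurable_fun setT (fun x => (\sum_i g i * \1_(C i) x)%:E).
Proof.
move=> mC; apply/measurable_EFinP; apply: measurable_sum => i.
by apply: measurable_funM => //; exact: measurable_indic.
Qed.

(** Turns a finite expectation into an integral, so that two of them can be compared point by
    point. *)
Lemma integral_sum_indic (I : finType) (C : I -> set T) (g : I -> R) :
  (forall i, measurable (C i)) -> (forall i, 0 <= g i) ->
  (\int[mu]_x (\sum_i g i * \1_(C i) x)%:E =
  (\sum_i g i * fine (mu (C i)))%:E)%E.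
Proof.
move=> mC g0; under eq_integral do rewrite -sumEFin.
rewrite ge0_integral_sum//; last 2 first.
- move=> i; apply/measurable_EFinP.
  by apply: measurable_funM => //; exact: measurable_indic.
- by move=> i x _; rewrite lee_fin mulr_ge0.
rewrite -sumEFin; apply: eq_bigr => i _.
under eq_integral do rewrite EFinM.
rewrite ge0_integralZl_EFin//; last first.
  by apply/measurable_EFinP; exact: measurable_indic.
by rewrite integral_indic// setIT EFinM fineK// fin_num_measure.
Qed.

Lemma sum_indic_cell (I : finType) (C : I -> set T) (g : I -> R) x i :
  C i x -> (forall j, C j x -> j = i) -> \sum_j g j * \1_(C j) x = g i.
Proof.
move=> Ci Cx; rewrite (bigD1 i)//= big1 => [|j ji].
  by rewrite indicE mem_set// mulr1 addr0.
rewrite indicE memNset ?mulr0// => /Cx ij.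
by rewrite ij eqxx in ji.
Qed.

Variable f : T -> T.
Hypothesis mf : measurable_fun setT f.

Lemma measurable_iter_preimage i (B : set T) :
  measurable B -> measurable (iter i f @^-1` B).
Proof.
move=> mB; elim: i => [//|i ih].
rewrite (_ : _ @^-1` B = f @^-1` (iter i f @^-1` B)).
  by rewrite -[X in measurable X]setTI; exact: mf.
by apply/funext => x /=; rewrite -iterSr.
Qed.

Variables (k : nat) (P : 'I_k -> set T).
Hypothesis partP : measurable_partition P.

Lemma measurable_iterated_join n w :
  measurable (iterated_join f P (n := n) w).
Proof.
have [mP _ _] := partP.
apply: fin_bigcap_measurable => [|i _]; first exact: finite_finset.
exact: measurable_iter_preimage.
Qed.

Lemma itinerary n x : exists w : {ffun 'I_n -> 'I_k},
  iterated_join f P w x /\ (forall v, iterated_join f P v x -> v = w).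
Proof.
have [_ tP cP] := partP.
have /choice[a ha] y : exists a : 'I_k, P a y.
  have : [set: T] y by []. by rewrite -cP => -[a _ ?]; exists a.
exists [ffun i : 'I_n => a (iter i f x)]; split=> [i _|v vx].
  by rewrite /preimage/= ffunE; exact: ha.
apply/ffunP => i; rewrite ffunE.
by apply: (tP) => //; exists (iter i f x); split; [exact: vx|exact: ha].
Qed.

Lemma partition_entropy_ge0 (I : finType) (Q : I -> set T) :
  (forall i, measurable (Q i)) -> 0 <= partition_entropy mu Q.
Proof.
move=> mQ; rewrite /partition_entropy oppr_ge0; apply: sumr_le0 => i _.
rewrite mulr_ge0_le0 ?fine_ge0// ln_le0// -lee_fin fineK ?fin_num_measure//.
exact: probability_le1.
Qed.

(** The words [c j] are infinite, so one family serves every [n]; [j] depends on the point but not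
    on the time. Gibbs' inequality is applied with [D] equal to [t] times the distance to the
    nearest word. *)
Lemma partition_entropy_le (n N : nat) (c : 'I_N.+1 -> nat -> 'I_k)
    (Bad : nat -> set T) (t e : R) :
  0 <= t -> (forall i, measurable (Bad i)) ->
  (forall i, (mu (Bad i) <= e%:E)%E) ->
  (forall x, exists j, forall i, ~ Bad i x -> P (c j i) (iter i f x)) ->
  partition_entropy mu (iterated_join f P (n := n)) <=
  ln N.+1%:R + n%:R * (k%:R * expR (- t) + t * e).
Proof.
move=> t0 mBad Bade hc.
have [_ tP _] := partP.
pose dist (w : {ffun 'I_n -> 'I_k}) j := (\sum_(i < n) (w i != c j i))%N.
pose J (w : {ffun 'I_n -> 'I_k}) := [arg min_(j < ord0) dist w j]%N.
have JP w j : (dist w (J w) <= dist w j)%N.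
  by rewrite /J; case: arg_minnP => // i _; exact.
pose p w := fine (mu (iterated_join f P (n := n) w)).
have mC := @measurable_iterated_join n.
have p1 : \sum_w p w = 1.
  have := @integral_sum_indic _ _ (fun=> 1) mC (fun=> ler01).
  under eq_integral => x _.
    have [w [wx wu]] := itinerary n x.
    rewrite (sum_indic_cell _ wx wu).
    over.
  rewrite integral_cst// mul1e. move=> /esym h.
  have [<-] := etrans h (probability_setT mu).
  by apply: eq_bigr => w _; rewrite mul1r.
(* At a point with itinerary [w], the nearest word is no farther than the one predicted there, which
   errs only at times [i] with the point in [Bad i]; this is then integrated. *)
have sD : \sum_w p w * (dist w (J w))%:R <= n%:R * e.
  apply: (@le_trans _ _ (\sum_(i < n) 1 * fine (mu (Bad i)))); last first.
    rewrite -[n in n%:R](card_ord n) mulr_natl -sumr_const; apply: ler_sum => i _.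
    by rewrite mul1r -lee_fin fineK ?fin_num_measure.
  under eq_bigr do rewrite mulrC.
  rewrite -lee_fin -!integral_sum_indic//; apply: ge0_le_integral => //.
  - by move=> x _; rewrite lee_fin sumr_ge0// => w _; rewrite mulr_ge0.
  - exact: measurable_sum_indic.
  - exact: (@measurable_sum_indic _ (fun i : 'I_n => Bad i)).
  move=> x _; rewrite lee_fin.
  have [w [wx wu]] := itinerary n x; rewrite (sum_indic_cell _ wx wu).
  have [j hj] := hc x.
  apply: (@le_trans _ _ (dist w j)%:R); first by rewrite ler_nat.
  rewrite natr_sum; apply: ler_sum => i _; rewrite mul1r indicE.
  have [bx|nbx] := pselect (Bad i x); first by rewrite mem_set// lern1 leq_b1.
  rewrite memNset// (_ : w i = c j i) ?eqxx//.
  by apply: tP => //; exists (iter i f x); split; [exact: wx|exact: hj].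
have rz : \sum_w expR (- (t * (dist w (J w))%:R)) <=
    N.+1%:R * (1 + k%:R * expR (- t)) ^+ n.
  apply: (@le_trans _ _ (\sum_w \sum_j expR (- (t * (dist w j)%:R)))).
    apply: ler_sum => w _; rewrite (bigD1 (J w))//= lerDl sumr_ge0//.
  rewrite exchange_big/= -[N.+1 in leRHS](card_ord N.+1) mulr_natl -sumr_const.
  by apply: ler_sum => j _; exact: (@sum_expR_hamming _ _ _ _ (fun i => c j i)).
have ke0 : 0 <= k%:R * expR (- t) by rewrite mulr_ge0 ?expR_ge0.
have p0 w : 0 <= p w by exact: fine_ge0.
apply: le_trans (gibbs p0 p1 rz) _.
rewrite lnM ?posrE ?exprn_gt0 ?ltr_wpDr// lnXn ?ltr_wpDr//.
rewrite addrCA lerD2l mulrDr addrC; apply: lerD.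
  by rewrite -[leLHS]mulr_natl ler_wpM2l// le_ln1Dx// (lt_le_trans _ ke0)// ltrN10.
rewrite [leRHS]mulrCA; apply: le_trans (ler_wpM2l t0 sD).
by rewrite mulr_sumr; under eq_bigr do rewrite mulrCA.
Qed.

End predictors.

(** * Approximation of Borel sets by sets that read a finite window *)

Lemma nondecreasing_bigcup_tail d (T : measurableType d) (R : realType)
    (mu : probability T R) (F : (set T)^nat) (e : R) :
  (forall n, measurable (F n)) -> {homo F : m n / (m <= n)%N >-> m `<=` n} ->
  0 < e -> exists n, (mu (\bigcup_i F i `\` F n) <= e%:E)%E.
Proof.
move=> mF ndF e0.
have mU : measurable (\bigcup_i F i) by exact: bigcup_measurable.
have ndF' : {homo F : m n / (m <= n)%N >-> (m <= n)%O}.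
  by move=> m n mn; apply/subsetPset; exact: ndF.
have : mu (F n) @[n --> \oo] --> (fine (mu (\bigcup_i F i)))%:E.
  by rewrite fineK ?fin_num_measure//; exact: nondecreasing_cvg_mu.
move=> /fine_cvgP[_ /cvgrPdist_lt /(_ e e0)[n _ /(_ n (leqnn n))/= h]].
exists n; rewrite measureD//; last by rewrite ltey_eq fin_num_measure.
rewrite (setIidr (@bigcup_sup _ _ n _ _ _))//.
move/ltW/(le_trans (ler_norm _)) : h.
by rewrite -lee_fin EFinB !fineK ?fin_num_measure.
Qed.

Section approximation.
Context {A : alphabetType} {R : realType}.
Variable mu : probability (borel_config A) R.

Definition windowed m (U : set (config A)) :=
  forall x y, cylinder m x y -> U x -> U y.

Lemma windowed_le m n U : (m <= n)%N -> windowed m U -> windowed n U.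
Proof. by move=> mn wU x y /(cylinder_le mn); exact: wU. Qed.

Lemma windowed_measurable m U :
  windowed m U -> measurable (U : set (borel_config A)).
Proof.
by move=> wU; apply: sub_sigma_algebra; exact: open_locally_cylinder wU.
Qed.

Lemma measurable_symdiff (B U : set (borel_config A)) :
  measurable B -> measurable U -> measurable (B `+` U).
Proof. by move=> mB mU; apply: measurableU; exact: measurableD. Qed.

Definition approximable (B : set (borel_config A)) := measurable B /\
  forall e : R, 0 < e -> exists m U, windowed m U /\
    (mu (B `+` U) <= e%:E)%E.

Lemma windowed_approximable m U : windowed m U -> approximable U.
Proof.
move=> wU; split; first exact: windowed_measurable wU.
move=> e e0; exists m, U; split => //.
by rewrite setYK measure0 lee_fin ltW.
Qed.

Lemma approximableC B : approximable B -> approximable (~` B).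
Proof.
move=> [mB aB]; split=> [|e /aB[m [U [wU h]]]]; first exact: measurableC.
exists m, (~` U); split.
  move=> x y xy nUx Uy; apply: nUx; apply: wU Uy.
  by rewrite -(cylinder_eq xy); exact: cylinder_refl.
rewrite (_ : _ `+` _ = B `+` U)// /setY !setDE !setCK setUC.
by rewrite (setIC U) (setIC (~` U)) setUC.
Qed.

(** A triangle inequality for symmetric differences; a general [W] lets it serve both for unions of
    two sets and for passing through an intermediate set. *)
Lemma measure_sub_symdiff_le (X Y Z V W : set (borel_config A)) (e : R) :
  measurable X -> measurable Y -> measurable Z -> measurable V ->
  measurable W -> (mu (X `+` Y) <= (e / 2)%:E)%E ->
  (mu (Z `+` V) <= (e / 2)%:E)%E ->
  W `<=` (X `+` Y) `|` (Z `+` V) -> (mu W <= e%:E)%E.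
Proof.
move=> mX mY mZ mV mW h1 h2 sub.
apply: (@le_trans _ _ (mu ((X `+` Y) `|` (Z `+` V)))).
  by apply: le_measure; rewrite ?inE//; apply: measurableU;
    exact: measurable_symdiff.
apply: (le_trans (measureU2 _ _ _)); try exact: measurable_symdiff.
by apply: (le_trans (leeD h1 h2)); rewrite -EFinD -splitr.
Qed.

Lemma approximableU B C :
  approximable B -> approximable C -> approximable (B `|` C).
Proof.
move=> [mB aB] [mC aC]; split=> [|e e0]; first exact: measurableU.
have e20 : 0 < e / 2 by rewrite divr_gt0.
have [m [U [wU hU]]] := aB _ e20.
have [n [V [wV hV]]] := aC _ e20.
have mU := windowed_measurable wU; have mV := windowed_measurable wV.
exists (maxn m n), (U `|` V); split.
  move=> x y xy [Ux|Vx]; [left|right].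
    exact: windowed_le (leq_maxl _ _) wU _ _ xy Ux.
  exact: windowed_le (leq_maxr _ _) wV _ _ xy Vx.
apply: (measure_sub_symdiff_le _ _ _ _ _ hU hV) => //.
  by apply: measurable_symdiff; exact: measurableU.
by move=> x /=; tauto.
Qed.

(** By continuity from below some [F n] is within [e / 2] of the union, and a windowed set is within
    [e / 2] of that [F n]. *)
Lemma approximable_nondecreasing (F : nat -> set (borel_config A)) :
  (forall n, approximable (F n)) ->
  {homo F : m n / (m <= n)%N >-> m `<=` n} -> approximable (\bigcup_n F n).
Proof.
move=> aF ndF; have mF n : measurable (F n) by have [] := aF n.
split=> [|e e0]; first exact: bigcup_measurable.
have e20 : 0 < e / 2 by rewrite divr_gt0.
have [n hn] := nondecreasing_bigcup_tail mu mF ndF e20.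
have [_ /(_ _ e20)[m [U [wU hU]]]] := aF n.
have mU := windowed_measurable wU.
have mcF : measurable (\bigcup_i F i) by exact: bigcup_measurable.
have sF : F n `<=` \bigcup_i F i by exact: bigcup_sup.
exists m, U; split => //.
apply: (@measure_sub_symdiff_le (\bigcup_i F i) (F n) (F n) U) => //.
- exact: measurable_symdiff.
- rewrite /setY (_ : F n `\` _ = set0) ?setU0//.
  by apply/seteqP; split => // x [/sF].
- move=> x /=; have [] := pselect (F n x); tauto.
Qed.

(** The approximable sets form a sigma-algebra. It contains every open [U], since the points whose
    cylinder of radius [n] lies in [U] form a windowed set that increases to [U]. *)
Lemma measurable_approximable B : measurable B -> approximable B.
Proof.
apply: (@smallest_sub _ _ _ approximable) => [|U oU].
  split.
  - by apply: (@windowed_approximable 0).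
  - by move=> C aC; rewrite setTD; exact: approximableC.
  (* Partial unions make the family nondecreasing. *)
  - move=> F aF; rewrite -bigcup_bigsetU_bigcup.
    apply: approximable_nondecreasing => [n|m n mn].
      elim/big_ind : _ => //; last exact: approximableU.
      exact: (@windowed_approximable 0).
    exact: subset_bigsetU.
rewrite (_ : U = \bigcup_n [set x : config A | cylinder n x `<=` U]).
  apply: approximable_nondecreasing => [n|m n mn x h].
    by apply: (@windowed_approximable n) => x y /cylinder_eq /= ->.
  exact: subset_trans (cylinder_le mn) h.
apply/seteqP; split => [x Ux|x [n _]]; last by apply; exact: cylinder_refl.
have [n h] := nbhs_cylinder_sub (open_nbhs_nbhs (conj oU Ux)).
by exists n.
Qed.

End approximation.

(** * Density points and countability of the dense classes *)

Section density.
Context {A : alphabetType} {R : realType}.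
Variable mu : probability (borel_config A) R.

Lemma cylinder_measurable n x : measurable (cylinder n x : set (borel_config A)).
Proof. by apply: sub_sigma_algebra; exact: open_cylinder. Qed.

(* The head of [p.2] is the letter at position [- p.1]. *)
Definition of_word (p : nat * seq A) : config A :=
  fun j => nth point p.2 (absz (j + p.1%:Z)).

(** Pairs of a radius and a finite word thus index all cylinders, which makes them countably
    many. *)
Lemma cylinder_of_word n x : exists w, cylinder n x = cylinder n (of_word (n, w)).
Proof.
exists (mkseq (fun i => x (i%:Z - n%:Z)) n.*2.+1).
apply: cylinder_eq => j hj; rewrite /of_word/= nth_mkseq; last by lia.
by congr x; lia.
Qed.

Definition density_one (x : config A) (B : set (config A)) :=
  (fun n => fine (mu (cylinder n x `&` B)) / fine (mu (cylinder n x))) @ \oo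
    --> (1 : R).

Definition charged : set (config A) :=
  [set x | forall n, (0 < mu (cylinder n x))%E].

Lemma measurable_charged : measurable (charged : set (borel_config A)).
Proof.
rewrite (_ : charged = \bigcap_n [set x | (0 < mu (cylinder n x))%E]).
  apply: bigcap_measurable => // n _; apply: (@windowed_measurable _ n).
  by move=> x y /cylinder_eq /= ->.
by apply/seteqP; split => [x h n _|x h n]; exact: h.
Qed.

(** With [B] fixed, the [n]-th quotient depends on [x] only through the window [[-n, n]], so each
    [S k n] is windowed, and convergence is a countable combination of these sets. *)
Lemma measurable_density_one B :
  measurable ([set x | density_one x B] : set (borel_config A)).
Proof.
pose q n x := fine (mu (cylinder n x `&` B)) / fine (mu (cylinder n x)).
pose S k n := [set x | `|1 - q n x| < k.+1%:R^-1].
rewrite (_ : [set _ | _] =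
    \bigcap_k \bigcup_N \bigcap_(n in [set n | (N <= n)%N]) S k n).
  apply: bigcap_measurable => // k _; apply: bigcup_measurable => N _.
  apply: bigcap_measurable => [|n _]; first by exists N => /=.
  apply: (@windowed_measurable _ n) => x y /cylinder_eq.
  by rewrite /S /q /= => ->.
apply/seteqP; split=> [x /cvgrPdist_lt h k _|x h].
  have [|N _ hN] := h k.+1%:R^-1; first by rewrite invr_gt0.
  by exists N.
apply/cvgrPdist_lt => e e0.
have [k hk] := ltr_add_invr (y := 0) (x := e) e0; rewrite add0r in hk.
have [N _ hN] := h k I.
by exists N => // n Nn; apply: lt_trans hk; exact: hN.
Qed.

Variable B : config A -> set (config A).
Hypotheses (mB : forall x, measurable (B x : set (borel_config A)))
  (B_eq : forall x y, B x y -> B x = B y).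

(* A cylinder is more than half covered by at most one class, and there are
   countably many cylinders. *)
Lemma countably_many_dense_classes :
  exists r : nat -> config A, forall x, charged x -> density_one x (B x) ->
    exists i, B x = B (r i).
Proof.
pose half (C : set (config A)) y :=
  fine (mu C) / 2 < fine (mu (C `&` B y)).
pose cyl (p : nat * seq A) := cylinder p.1 (of_word p).
have half_eq p x y : half (cyl p) x -> half (cyl p) y -> B x = B y.
  move=> hx hy; have mC : measurable (cyl p : set (borel_config A)).
    exact: cylinder_measurable.
  have [[z [xz yz]]|nxy] := pselect (exists z, B x z /\ B y z).
    by rewrite (B_eq xz) (B_eq yz).
  have mI z : measurable (cyl p `&` B z : set (borel_config A)).
    exact: measurableI.
  have : (mu ((cyl p `&` B x) `|` (cyl p `&` B y)) <= mu (cyl p))%E.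
    apply: le_measure; rewrite ?inE//; first exact: measurableU.
    by move=> z /=; tauto.
  rewrite measureU//; last first.
    by apply/seteqP; split => // z [[_ ?] [_ ?]]; apply: nxy; exists z.
  move=> le_sum; move: hx hy; rewrite /half.
  have : fine (mu (cyl p `&` B x)) + fine (mu (cyl p `&` B y)) <=
      fine (mu (cyl p)).
    by rewrite -lee_fin EFinD !fineK ?fin_num_measure.
  by move=> h hx hy; have := ltrD hx hy; rewrite -splitr ltNge h.
(* [s p] represents the class that fills more than half of [cyl p], if there is one. *)
have /choice[s hs] p : exists x, forall y, half (cyl p) y -> B y = B x.
  have [[x hx]|nx] := pselect (exists x, half (cyl p) x).
    by exists x => y hy; exact: half_eq hx.
  by exists point => y hy; exfalso; apply: nx; exists y.
exists (fun i => s (odflt (0%N, [::]) (unpickle i))) => x cx.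
have i2 : 0 < (1 / 2 : R) by rewrite divr_gt0.
move=> /cvgrPdist_lt /(_ _ i2)[n _ /(_ n (leqnn n))/= h].
have [w xw] := cylinder_of_word n x.
exists (pickle (n, w)); rewrite pickleK/=; apply: hs.
rewrite /half /cyl/= -xw.
have c0 : 0 < fine (mu (cylinder n x)).
  rewrite -lte_fin fineK ?fin_num_measure//; exact: cylinder_measurable.
rewrite mulrC -ltr_pdivlMr//.
by move: h => /ltr_normlP[]; lra.
Qed.

End density.

(** * Orbit classes and equicontinuous points *)

Section orbits.
Context {A : alphabetType} {R : realType}.
Variables (mu : probability (borel_config A) R) (F : config A -> config A).
Hypothesis cF : continuous F.

Lemma iter_continuous i : continuous (iter i F).
Proof.
elim: i => [|i ih] x; first exact: cvg_id.
by move=> U /(cF (x := _)) FU; exact: ih FU.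
Qed.

Lemma measurable_continuous_config :
  @measurable_fun _ _ (borel_config A) (borel_config A) setT F.
Proof.
apply: (@measurability _ _ (borel_config A) (borel_config A) setT F
  (@open (config A))) => // _ [U oU <-].
by rewrite setTI; apply: sub_sigma_algebra; exact: (continuousP F).1.
Qed.

Lemma orbit_cylinder_refl m x : orbit_cylinder F m x x.
Proof. by []. Qed.

Lemma orbit_cylinder_eq m x y :
  orbit_cylinder F m x y -> orbit_cylinder F m x = orbit_cylinder F m y.
Proof. by move=> xy; apply/seteqP; split => z h i j hj; rewrite h// xy. Qed.

Lemma orbit_cylinder_measurable m x :
  measurable (orbit_cylinder F m x : set (borel_config A)).
Proof.
rewrite (_ : orbit_cylinder F m x =
    \bigcap_i (iter i F @^-1` cylinder m (iter i F x))).
  apply: bigcap_measurable => // i _; apply: sub_sigma_algebra.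
  by apply: (continuousP _).1; [exact: iter_continuous|exact: open_cylinder].
by apply/seteqP; split => [y h i _ j|y h i j]; [exact: h|exact: (h i I)].
Qed.

(* The set of equicontinuous points is not assumed measurable, so its
   measurability must be established before its measure carries information. *)
Lemma measurable_equicontinuous_point :
  measurable ([set x | mu_equicontinuous_point mu F x] : set (borel_config A)).
Proof.
rewrite (_ : [set _ | _] = \bigcap_m ([set x | charged mu x] `&`
    [set x | density_one mu x (orbit_cylinder F m x)])); last first.
  apply/seteqP; split => [x [h1 h2] m _|x h]; first by split => //; exact: h2.
  by split => [|m]; [have [] := h 0%N I|have [] := h m I].
apply: bigcap_measurable => // m _.
have [r hr] := countably_many_dense_classes mu
  (orbit_cylinder_measurable m) (@orbit_cylinder_eq m).
(* The set [orbit_cylinder F m x] moves with [x] but is constant on each class, so on the class of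
   [r i] the density refers to a fixed set. *)
rewrite (_ : _ `&` _ = \bigcup_i (orbit_cylinder F m (r i) `&` (charged mu `&`
   [set x | density_one mu x (orbit_cylinder F m (r i))]))).
  apply: bigcup_measurable => i _.
  apply: measurableI; first exact: orbit_cylinder_measurable.
  by apply: measurableI; [exact: measurable_charged|exact: measurable_density_one].
apply/seteqP; split=> [x [cx dx]|x [i _ [rx [cx dx]]]].
  have [i xi] := hr _ cx dx; exists i => //.
  split; last by split=> //=; rewrite -xi.
  by rewrite -xi; exact: orbit_cylinder_refl.
by split => //=; rewrite -(orbit_cylinder_eq rx).
Qed.

Hypothesis eqF : mu_equicontinuous mu F.

Lemma orbit_cylinders_cover m : exists r : nat -> config A,
  mu (\bigcup_i orbit_cylinder F m (r i)) = 1%E.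
Proof.
have [r hr] := countably_many_dense_classes mu
  (orbit_cylinder_measurable m) (@orbit_cylinder_eq m).
exists r; have mU : measurable
    (\bigcup_i orbit_cylinder F m (r i) : set (borel_config A)).
  by apply: bigcup_measurable => i _; exact: orbit_cylinder_measurable.
apply/eqP; rewrite eq_le probability_le1//= -[leLHS]eqF.
apply: le_measure; rewrite ?inE//; first exact: measurable_equicontinuous_point.
move=> x [cx dx]; have [i xi] := hr _ cx (dx m).
by exists i => //; rewrite -xi; exact: orbit_cylinder_refl.
Qed.

End orbits.

(** * Prediction of itineraries and vanishing of the entropy *)

Section conclusion.
Context {A : alphabetType} {R : realType}.
Variables (mu : probability (borel_config A) R) (F : config A -> config A).
Hypotheses (cF : continuous F) (invF : invariant_measure mu F)
  (eqF : mu_equicontinuous mu F).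

Lemma invariant_iter i (B : set (borel_config A)) :
  measurable B -> mu (iter i F @^-1` B) = mu B.
Proof.
move=> mB; elim: i => [//|i ih]; rewrite -ih -[RHS]invF.
  by congr (mu _); apply/funext => x /=; rewrite -iterSr.
exact: measurable_iter_preimage (measurable_continuous_config cF) _ _ mB.
Qed.

Variables (k : nat) (P : 'I_k -> set (borel_config A)).
Hypothesis partP : measurable_partition P.

(** Each cell [P a] is approximated by a windowed [U a], and the guess is some [a] with [x] in
    [U a]. Off the union of the symmetric differences, [x] lies in [U a] exactly when it lies in
    [P a], so the guess is right. *)
Lemma windowed_guess (e : R) : 0 < e ->
  exists m (g : config A -> 'I_k) (E : set (borel_config A)),
  [/\ forall x y, cylinder m x y -> g x = g y, measurable E,
      (mu E <= e%:E)%E & forall x, ~ E x -> P (g x) x].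
Proof.
move=> e0; have [mP tP cP] := partP.
have exP x : exists a, P a x.
  have : [set: borel_config A] x by []. by rewrite -cP => -[a _ ?]; exists a.
have [a0 _] := exP point.
have k0 : 0 < k%:R :> R by rewrite ltr0n; case: (k) a0 => // -[].
have ek0 : 0 < e / k%:R by rewrite divr_gt0.
have /choice[m /choice[U hU]] a := (measurable_approximable mu (mP a)).2 _ ek0.
(* The default [a0] can be returned only at points of the exceptional set. *)
pose g x := odflt a0 [pick a | `[< U a x >]].
pose S a := P a `+` U a.
have mS a : measurable (S a).
  by apply: measurable_symdiff => //; exact: windowed_measurable (hU a).1.
have [mE mue] : measurable (\big[setU/set0]_a S a) /\
    (mu (\big[setU/set0]_a S a) <= (\sum_(a < k) e / k%:R)%:E)%E.
  elim/big_ind2 : _ => [|X x Y y [mX hX] [mY hY]|a _].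
  - by rewrite measure0.
  - split; first exact: measurableU.
    by apply: (le_trans (measureU2 mu mX mY)); rewrite EFinD leeD.
  - by split => //; exact: (hU a).2.
exists (\max_a m a)%N, g, (\big[setU/set0]_a S a); split => //.
- move=> x y xy; rewrite /g; congr odflt; apply: eq_pick => a /=.
  apply/asbool_equiv_eq; have wU : windowed (\max_a m a)%N (U a).
    by apply: windowed_le (hU a).1; exact: leq_bigmax.
  split; [exact: wU|apply: wU].
  by rewrite -(cylinder_eq xy); exact: cylinder_refl.
- apply: le_trans mue _; rewrite sumr_const card_ord -(mulr_natr (e / _)).
  by rewrite divfK// gt_eqF.
move=> x nEx; have nS a : ~ S a x.
  by move=> Sax; apply: nEx; rewrite (bigD1 a)//=; left.
rewrite /g; case: pickP => [a /asboolP Ua|nU] /=.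
  by apply: contrapT => nPa; apply: (nS a); right.
have [a Pa] := exP x; exfalso; apply: (nS a); left; split=> //.
by move=> Uax; have := nU a; rewrite /= asboolT.
Qed.

(** Word [j] is the guessed itinerary of [r j]; the points of its orbit class share it, since the
    guess reads only the window. Time [i] is bad if the point misses the chosen classes or its
    [i]-th iterate falls in [E]; invariance bounds the latter uniformly in [i]. *)
Lemma predictors (e : R) : 0 < e ->
  exists N (c : 'I_N.+1 -> nat -> 'I_k) (Bad : nat -> set (borel_config A)),
  [/\ forall i, measurable (Bad i), forall i, (mu (Bad i) <= e%:E)%E &
    forall x, exists j, forall i, ~ Bad i x -> P (c j i) (iter i F x)].
Proof.
move=> e0; have e20 : 0 < e / 2 by rewrite divr_gt0.
have [m [g [E [wg mE hE gP]]]] := windowed_guess e20.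
have [r r1] := orbit_cylinders_cover cF eqF m.
pose O i : set (borel_config A) := orbit_cylinder F m (r i).
have mO i : measurable (O i) by exact: orbit_cylinder_measurable.
pose G n := \big[setU/set0]_(i < n.+1) O i.
have mG n : measurable (G n) by exact: bigsetU_measurable.
have [N hN] : exists N, (mu (\bigcup_i G i `\` G N) <= (e / 2)%:E)%E.
  by apply: nondecreasing_bigcup_tail => // p q pq; exact: subset_bigsetU.
have GE : \bigcup_i G i = \bigcup_i O i by exact: bigcup_bigsetU_bigcup.
have mGN : (mu (~` G N) <= (e / 2)%:E)%E.
  have mUG : measurable (\bigcup_i G i) by exact: bigcup_measurable.
  (* A point outside [G N] lies in the null complement of all the classes or in the tail beyond
     [G N]. *)
  apply: le_trans hN; rewrite -[leRHS]add0e.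
  rewrite -[X in (X + _)%E](_ : mu (~` \bigcup_i G i) = 0%E).
    apply: le_trans (measureU2 mu _ _); [|exact: measurableC|exact: measurableD].
    apply: le_measure; rewrite ?inE; [exact: measurableC| |].
      by apply: measurableU; [exact: measurableC|exact: measurableD].
    by move=> x /=; have [] := pselect ((\bigcup_i G i) x); tauto.
  by rewrite probability_setC// GE r1 subee.
exists N, (fun j i => g (iter i F (r j))), (fun i => iter i F @^-1` E `|` ~` G N).
have mFE i : measurable (iter i F @^-1` E : set (borel_config A)).
  exact: measurable_iter_preimage (measurable_continuous_config cF) _ _ mE.
split=> [i|i|x].
- by apply: measurableU => //; exact: measurableC.
- have hFE : (mu (iter i F @^-1` E) <= (e / 2)%:E)%E by rewrite invariant_iter.
  apply: (le_trans (measureU2 mu _ _)) => //; first exact: measurableC.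
  by rewrite [e]splitr EFinD; exact: leeD.
(* Outside [G N] every time is bad, so any word will do. *)
have [|nGx] := pselect (G N x); last by exists ord0 => i []; right.
rewrite /G -bigcup_mkord => -[j /= jN Ojx].
exists (inord j) => i /not_orP[nE _]; rewrite inordK//.
rewrite (wg _ (iter i F x)); first exact: gP.
by move=> l hl; exact: Ojx.
Qed.

Lemma entropy_wrt0 : entropy_wrt mu F P = 0.
Proof.
apply: cvg_lim => //; apply/cvgrPdist_le => eta eta0.
have eta3 : 0 < eta / 3 by rewrite divr_gt0.
(* Chosen so that [k%:R * expR (- t)] is at most [eta / 3]; the summand [1] keeps [t]
   nonnegative. *)
pose t : R := ln (1 + k%:R / (eta / 3)).
have q1 : 1 <= 1 + k%:R / (eta / 3) by rewrite lerDl divr_ge0// ltW.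
have q0 : 0 < 1 + k%:R / (eta / 3) by rewrite (lt_le_trans _ q1).
have t0 : 0 <= t by exact: ln_ge0.
have ht : k%:R * expR (- t) <= eta / 3.
  rewrite expRN lnK ?posrE// ler_pdivrMr// mulrDr mulr1.
  by rewrite [X in _ + X]mulrC divfK ?gt_eqF// lerDr ltW.
(* Dividing by [t + 1] instead of [t] requires only [0 <= t]. *)
pose e := eta / 3 / (t + 1).
have t10 : 0 < t + 1 by rewrite ltr_wpDl.
have e0 : 0 < e by rewrite divr_gt0.
have hte : t * e <= eta / 3.
  by rewrite /e mulrA ler_pdivrMr// mulrC ler_wpM2l ?lerDl// ltW.
have [N [c [Bad [mBad hBad hc]]]] := predictors e0.
have lnN0 : 0 <= ln N.+1%:R :> R by rewrite ln_ge0// ler1n.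
(* [N] is fixed before [n], so for large [n] the constant [ln N.+1%:R] is at most
   [n%:R * (eta / 3)]; such [n] are also positive. *)
exists (Num.bound (ln N.+1%:R / (eta / 3))) => // n /= hn.
have mF := measurable_continuous_config cF.
have H0 :
    0 <= partition_entropy mu (iterated_join (T := borel_config A) F P (n := n)).
  by apply: partition_entropy_ge0 => w; exact: measurable_iterated_join.
rewrite sub0r normrN ger0_norm ?divr_ge0//.
have b0 : 0 <= ln N.+1%:R / (eta / 3) :> R by rewrite divr_ge0// ltW.
have n0 : 0 < n%:R :> R.
  apply: (le_lt_trans b0); apply: lt_le_trans (archi_boundP b0) _.
  by rewrite ler_nat.
have hn' : ln N.+1%:R <= n%:R * (eta / 3) :> R.
  rewrite -ler_pdivrMr//; apply: ltW; apply: lt_le_trans (archi_boundP b0) _.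
  by rewrite ler_nat.
rewrite ler_pdivrMr// mulrC.
apply: (le_trans (partition_entropy_le mF partP n t0 mBad hBad hc)).
apply: (@le_trans _ _ (n%:R * (eta / 3) + n%:R * (eta / 3 + eta / 3))).
  by apply: lerD => //; rewrite ler_wpM2l// lerD.
by rewrite -mulrDr ler_wpM2l//; lra.
Qed.

End conclusion.

Theorem proposition4 (R : realType) (A : alphabetType)
  (F : config A -> config A) (mu : probability (borel_config A) R)
  (hF : cellular_automaton F)
  (hinv : invariant_measure mu F)
  (heq : mu_equicontinuous mu F) :
  ks_entropy mu F = 0%E.
Proof.
rewrite /ks_entropy [X in ereal_sup X](_ : _ = [set 0%E]) ?ereal_sup1//.
apply/seteqP; split => [h [k [P [partP ->]]]|_ ->] /=.
  by rewrite (entropy_wrt0 hF.1 hinv heq partP).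
(* The one-cell partition shows that the value [0] is attained; the supremum of an empty set would
   be minus infinity. *)
have partT : @measurable_partition _ (borel_config A) 1 (fun=> [set: _]).
  split => //; first by move=> i j _ _ _; rewrite !ord1.
  by apply/seteqP; split => // x _; exists ord0.
by exists 1%N, (fun=> [set: _]); rewrite (entropy_wrt0 hF.1 hinv heq partT).
Qed.
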